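(* There is an absolute constant $C>0$ such that for every integer $m\ge1$, with $q=2^m$, there are at least $1+\frac{q^3-Cq^{5/2}}{7}$ elements $\mu\in\mathbb{F}_{q^3}$ for which $f_\mu^{(1)}(x)=x^{2q}+\mu x^{2}+x$ is a permutation of $\mathbb{F}_{q^3}$. *)

(* Defs.v *)
From mathcomp Require Import all_boot all_order all_algebra.

Set Implicit Arguments.
Unset Strict Implicit.
Unset Printing Implicit Defensive.

Import GRing.Theory.
Local Open Scope ring_scope.

Definition f1 (F : fieldType) (q : nat) (mu x : F) : F :=
  x ^+ (2 * q)%N + mu * x ^+ 2 + x.

(* Main.v *)
Require Import Defs.
From mathcomp Require Import all_boot all_order all_algebra.
From mathcomp Require Import finfield.
From mathcomp Require Import boolp reals exp.
From mathcomp Require Import zify ring lra.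

Set Implicit Arguments.
Unset Strict Implicit.
Unset Printing Implicit Defensive.

Import Order.TTheory GRing.Theory Num.Theory.
Local Open Scope ring_scope.

(* Write f_mu for the polynomial x^(2q) + mu x^2 + x. It is additive and has
   r(mu) <= 7 nonzero roots, so that it is a permutation iff r(mu) = 0; as
   (r - 1)(r - 7) <= 0 for 1 <= r <= 7, the number of permutations is at least
   the sum over mu of (r - 1)(r - 7) / 7. Each x != 0 is a root of exactly one
   f_mu, hence r sums to q^3 - 1, and it remains to bound below the number of
   pairs x, y = t x (t != 1) of nonzero roots of the same f_mu. For t not in F_q
   this means x^(2q-1) = c(t), where c(t) = t(1+t)/(t+t^q)^2. If P is the group of
   (2q-1)-th powers, of index k <= 7, there are k solutions x when c(t) is in P.

   To count the t with c(t) in P, replace t by t/s with s in F_q^*: then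
   c(t/s) = a_t (s + t) with a_t independent of s. So one needs to know that for
   every a != 0 about q/k elements s of F_q satisfy a(s + t) in P, up to
   O(sqrt q). This is a second moment computation over a, in which the pairs
   (s, s') with (s+t)/(s'+t) in P are controlled by the fact that the map
   (s, s') |-> (s+t)/(s'+t) is injective for s != s', even modulo F_q^*, because
   1, t, t^2 are linearly independent over F_q (two lines of a projective plane
   meet in one point). Note F_q^* is contained in P, as x^(2q-1) = x on F_q^*. *)

(** * Numerical inequalities and counting by fibres *)

(** In use, [r] is q, [x] the index of P, [p] its order, [E] the number of ratio pairs and [b] a
    coset count. Dividing by [p] and inserting the bound on [E] gives (xb - r)^2 <= (x^2 + x) r, and
    56 = 7^2 + 7; the square is expanded to avoid subtraction in [nat]. *)
Lemma variance_bound (r x p E b : nat) :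
  (1 < r)%N -> (p * x)%N = (r ^ 3).-1 -> (r.-1 * (E + 1) <= p + r * r.-1)%N ->
  (0 < x)%N -> (x <= 7)%N -> (0 < p)%N ->
  p%:Z * ((x * b)%:Z - r%:Z) ^+ 2 <=
    x%:Z ^+ 2 * (E * p)%:Z - 2 * x%:Z * r%:Z * (r * p)%:Z + (p * x)%:Z * r%:Z ^+ 2 ->
  ((x * b) ^ 2 + r ^ 2 <= 2 * (x * b) * r + 56 * r)%N.
Proof.
case: r => // r r1 px leE x0 x7 p0 le.
have {}le : ((x * b)%:Z - r.+1%:Z) ^+ 2 <= x%:Z ^+ 2 * E%:Z - x%:Z * r.+1%:Z ^+ 2.
  by rewrite -(ler_pM2l (_ : 0 < p%:Z)) //; apply: le_trans le _; lia.
have {px} pxE : (p * x = r * (r.+1 ^ 2 + r.+1 + 1))%N.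
  by rewrite px; lia.
have {}leE : (x * E <= r.+1 ^ 2 + r.+1 + 1 + x * r)%N.
  rewrite -(leq_pmul2l (_ : 0 < r)%N) //.
  have : (x * (r * (E + 1)) <= p * x + x * (r.+1 * r))%N.
    by rewrite [(p * x)%N]mulnC -mulnDr leq_mul2l leE orbT.
  rewrite pxE; lia.
have h1 : (x * (x * E) <= x * (r.+1 ^ 2 + r.+1 + 1 + x * r))%N by rewrite leq_mul2l leE orbT.
have h2 : ((x * x + x) * r.+1 <= 56 * r.+1)%N.
  by rewrite leq_mul2r (leq_add (leq_mul x7 x7) x7).
have h3 : (x * 1 <= x * x)%N by rewrite leq_mul2l x0 orbT.
clear -le h1 h2 h3; lia.
Qed.

Lemma natr_sqrB_le (R : realDomainType) (b r c : nat) :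
  (b ^ 2 + r ^ 2 <= 2 * b * r + c * r)%N ->
  (b%:R - r%:R) ^+ 2 <= c%:R * r%:R :> R.
Proof. by rewrite -(ler_nat R) !(natrD, natrM, natrX) => h; lra. Qed.

Lemma card_sum_fibres (T U : finType) (f : T -> U) (A : {set T}) (D : {set U}) :
  {in A, forall x, f x \in D} ->
  #|A| = (\sum_(c in D) #|[set x in A | f x == c]|)%N.
Proof.
move=> fAD; rewrite -sum1_card (partition_big f (mem D)) //=.
by apply: eq_bigr => c _; rewrite -sum1_card; apply: eq_bigl => x; rewrite inE.
Qed.

Lemma sum_sqr_card_fibres (T U : finType) (f : T -> U) (A : {set T}) :
  (\sum_c #|[set x in A | f x == c]| ^ 2 =
   #|[set p in setX A A | f p.1 == f p.2]|)%N.
Proof.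
rewrite (@card_sum_fibres _ _ (fun p : T * T => f p.1) _ setT) => [|p]; last by rewrite inE.
apply: eq_big => [c|c _]; first by rewrite inE.
rewrite -mulnn -cardsX; apply: eq_card => -[x y]; rewrite !inE /=.
case: eqP => [->|_]; last by rewrite !andbF.
by rewrite !andbT [c == _]eq_sym andbA.
Qed.

(** * Powers and roots of unity in a finite field *)

Section FiniteField.
Variable F : finFieldType.

Lemma card_roots_lt (p : {poly F}) (A : {set F}) :
  p != 0 -> {in A, forall x, root p x} -> (#|A| < size p)%N.
Proof.
move=> p0 Ap; rewrite cardE; apply: max_poly_roots => //; last exact: enum_uniq.
by apply/allP => x; rewrite mem_enum; apply: Ap.
Qed.

Variable n : nat.

(** The kernel of z |-> z^n on F^*; its order is the index of the image [powers]. *)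
Definition unity_roots : {set F} := [set z | (z != 0) && (z ^+ n == 1)].
Definition powers : {set F} := [set z ^+ n | z in [set~ 0]].

Lemma powersP c : reflect (exists2 z, z != 0 & c = z ^+ n) (c \in powers).
Proof.
apply: (iffP imsetP) => -[z]; rewrite ?inE => z0 ->; exists z => //.
by rewrite !inE.
Qed.

Lemma powers0 : 0 \notin powers.
Proof. by apply/powersP => -[z z0 /esym/eqP]; rewrite (negPf (expf_neq0 _ z0)). Qed.

Lemma powers1 : 1 \in powers.
Proof. by apply/powersP; exists 1; rewrite ?oner_neq0 ?expr1n. Qed.

Lemma powersV x : x \in powers -> x^-1 \in powers.
Proof. by case/powersP=> z z0 ->; apply/powersP; exists z^-1; rewrite ?invr_eq0 ?exprVn. Qed.

Lemma powersM x y : x \in powers -> y \in powers -> x * y \in powers.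
Proof.
case/powersP=> z z0 -> /powersP[w w0 ->]; apply/powersP.
by exists (z * w); rewrite ?mulf_neq0 ?exprMn.
Qed.

Lemma powers_neq0 x : x \in powers -> x != 0.
Proof. by move=> Px; apply: contraNneq powers0 => <-. Qed.

Lemma powersMl x y : x \in powers -> (x * y \in powers) = (y \in powers).
Proof.
move=> Px; apply/idP/idP => [|Py]; last exact: powersM.
by move/(powersM (powersV Px)); rewrite mulKf // powers_neq0.
Qed.

Lemma card_powers_fibre c : c \in powers ->
  #|[set z | (z != 0) && (z ^+ n == c)]| = #|unity_roots|.
Proof.
case/powersP=> w w0 ->; rewrite -(card_imset unity_roots (mulfI w0)).
apply: eq_card => z; apply/idP/imsetP => [|[u]]; rewrite !inE => /andP[].
  move=> z0 /eqP zw.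
  exists (w^-1 * z); last by rewrite mulVKf.
  by rewrite inE mulf_neq0 ?invr_eq0 //= exprMn zw exprVn mulVf ?expf_neq0 .
by move=> u0 /eqP u1 ->; rewrite mulf_neq0 //= exprMn u1 mulr1 eqxx.
Qed.

Lemma card_powers : (#|powers| * #|unity_roots| = #|F|.-1)%N.
Proof.
rewrite -(cardsC1 (0 : F)) (@card_sum_fibres _ _ (fun z => z ^+ n) [set~ 0] powers).
  rewrite -sum_nat_const; apply: eq_bigr => c cP; rewrite -(card_powers_fibre cP).
  by apply: eq_card => z; rewrite !inE.
by move=> z; rewrite !inE => z0; apply/powersP; exists z.
Qed.

Lemma card_powers_scale u : u != 0 -> #|[set a | a * u \in powers]| = #|powers|.
Proof.
move=> u0; rewrite -(card_imset _ (mulIf u0)); apply: eq_card => y.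
apply/imsetP/idP => [[a]|yP]; first by rewrite inE => ? ->.
by exists (y / u); rewrite ?inE divfK.
Qed.

End FiniteField.

(** * The subfield F_q of F in characteristic 2 *)

Section Cubic.
Variables (m : nat) (F : finFieldType).
Hypothesis m_gt0 : (0 < m)%N.
Local Notation q := (2 ^ m)%N.
Hypothesis cardF : #|F| = (q ^ 3)%N.

Let q_gt1 : (1 < q)%N. Proof. by rewrite -{1}(expn0 2) ltn_exp2l. Qed.

Lemma pchar2 : 2%N \in [pchar F].
Proof. by apply: (@card_finPcharP _ 2 (m * 3)); rewrite ?cardF ?expnM. Qed.

Lemma addff (x : F) : x + x = 0.
Proof. by have := mulrn_pchar pchar2 x; rewrite mulr2n. Qed.

Lemma expD2X i (x y : F) : (x + y) ^+ (2 ^ i) = x ^+ (2 ^ i) + y ^+ (2 ^ i).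
Proof. by apply: exprDn_pchar; rewrite (eq_pnat _ (pcharf_eq pchar2)) pnatX. Qed.

Lemma expqD (x y : F) : (x + y) ^+ q = x ^+ q + y ^+ q.
Proof. exact: expD2X. Qed.

Lemma expq3 (x : F) : x ^+ q ^+ q ^+ q = x.
Proof. by rewrite -!exprM -[RHS]expf_card cardF; congr (_ ^+ _); lia. Qed.

Definition Fq : {set F} := [set x | x ^+ q == x].

Lemma FqP x : reflect (x ^+ q = x) (x \in Fq).
Proof. by rewrite inE; exact: eqP. Qed.

Lemma Fq0 : 0 \in Fq. Proof. by rewrite inE expr0n; case: q q_gt1. Qed.
Lemma FqD x y : x \in Fq -> y \in Fq -> x + y \in Fq.
Proof. by move=> /FqP hx /FqP hy; apply/FqP; rewrite expqD hx hy. Qed.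
Lemma FqM x y : x \in Fq -> y \in Fq -> x * y \in Fq.
Proof. by move=> /FqP hx /FqP hy; apply/FqP; rewrite exprMn hx hy. Qed.
Lemma FqV x : x \in Fq -> x^-1 \in Fq.
Proof. by move=> /FqP hx; apply/FqP; rewrite exprVn hx. Qed.

(** The upper bound counts roots of X^q - X. For the lower bound, the trace maps F to [Fq] with
    fibres of size at most q^2. *)
Lemma card_Fq : #|Fq| = q.
Proof.
apply/eqP; rewrite eqn_leq; apply/andP; split.
  have sz : size ('X^q - 'X : {poly F}) = q.+1.
    by rewrite size_polyDl size_polyXn // size_polyN size_polyX.
  rewrite -ltnS -sz; apply: card_roots_lt; first by rewrite -size_poly_gt0 sz.
  by move=> x /FqP xq; rewrite rootE !hornerE xq subrr.
pose tr (x : F) := x + x ^+ q + x ^+ q ^+ q.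
have trF x : x \in [set: F] -> tr x \in Fq.
  by move=> _; apply/FqP; rewrite /tr !expqD expq3 addrC addrA.
rewrite -(leq_pmul2r (_ : 0 < q ^ 2)%N) ?expn_gt0 // -expnS -cardF -cardsT.
rewrite (card_sum_fibres trF) -sum_nat_const; apply: leq_sum => c _.
pose p : {poly F} := 'X^(q ^ 2) + ('X^q + ('X - c%:P)).
have sz : size p = (q ^ 2).+1.
  rewrite /p size_polyDl size_polyXn // size_polyDl size_polyXn ?size_XsubC //.
  by rewrite ltnS -{1}(expn1 q) ltn_exp2l.
rewrite -ltnS -sz; apply: card_roots_lt; first by rewrite -size_poly_gt0 sz.
move=> x; rewrite !inE /tr => /eqP trx; rewrite rootE /p !(hornerD, hornerN, hornerXn, hornerX, hornerC) -trx -exprM mulnn.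
by apply/eqP; set u := x ^+ (q ^ 2); set v := x ^+ q; ring.
Qed.

Lemma oppF (x : F) : - x = x.
Proof. by apply/eqP; rewrite eq_sym -addr_eq0 addff. Qed.

Lemma FqB x y : x \in Fq -> y \in Fq -> x - y \in Fq.
Proof. by rewrite oppF; exact: FqD. Qed.

(* A root t of a monic quadratic over Fq has t ^+ q among its at most two roots,
   so the q-Frobenius, which has order dividing 3 on t, acts on t with order at
   most 2, hence trivially. *)
Lemma Fq_quadratic t a b :
  t \notin Fq -> a \in Fq -> b \in Fq -> t ^+ 2 <> a * t + b.
Proof.
move=> tF /FqP aq /FqP bq t2; pose u := t ^+ q.
have ut : u != t by move: tF; rewrite inE.
have u2 : u ^+ 2 = a * u + b by rewrite /u -exprM mulnC exprM t2 expqD exprMn aq bq.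
have /eqP : (u - t) * (u + t - a) = 0.
  by transitivity ((u ^+ 2 - a * u) - (t ^+ 2 - a * t)); [ring | rewrite u2 t2; ring].
rewrite mulf_eq0 !subr_eq0 (negPf ut) /= => /eqP uta.
have uE : u = a + t by rewrite -uta -addrA addff addr0.
have uq : u ^+ q = t by rewrite uE expqD aq -/u uE addrA addff add0r.
by case/eqP: ut; rewrite /u -{2}(expq3 t) -/u uq.
Qed.

Lemma Fq_indep t a b c : t \notin Fq -> a \in Fq -> b \in Fq -> c \in Fq ->
  a * t ^+ 2 + b * t + c = 0 -> [/\ a = 0, b = 0 & c = 0].
Proof.
move=> tF aF bF cF e.
have [a0|a0] := eqVneq a 0; last first.
  case: (@Fq_quadratic t (- (a^-1 * b)) (- (a^-1 * c))) => //.
  - by rewrite oppF FqM ?FqV.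
  - by rewrite oppF FqM ?FqV.
  apply: (mulfI a0); rewrite -[LHS](addrK (b * t + c)) addrA e; field.
  exact: a0.
move: e; rewrite a0 mul0r add0r => e.
have [b0|b0] := eqVneq b 0; first by split=> //; rewrite -e b0 mul0r add0r.
case/negP: tF; suff -> : t = b^-1 * c by rewrite FqM ?FqV.
apply: (mulfI b0); rewrite mulVKf //.
by move/eqP: e; rewrite addr_eq0 oppF => /eqP.
Qed.

Lemma Fq_addt_neq0 s t : s \in Fq -> t \notin Fq -> s + t != 0.
Proof. by move=> sF; apply: contra; rewrite addr_eq0 oppF => /eqP <-. Qed.

(** Cleared of denominators, the equation is a quadratic relation for [t] over F_q, so l = l', s +
    r' = r + s' and s r' = r s'; these give (s - s')(s - r) = 0. *)
Lemma ratio_inj t s s' r r' l l' : t \notin Fq ->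
  s \in Fq -> s' \in Fq -> r \in Fq -> r' \in Fq -> l \in Fq -> l' \in Fq ->
  s != s' -> l != 0 -> l * ((s + t) / (s' + t)) = l' * ((r + t) / (r' + t)) ->
  [/\ s = r, s' = r' & l = l'].
Proof.
move=> tF sF s'F rF r'F lF l'F ss' l0 e.
have s't := Fq_addt_neq0 s'F tF; have r't := Fq_addt_neq0 r'F tF.
have {}e : l * (s + t) * (r' + t) = l' * (r + t) * (s' + t).
  apply: (mulIf (invr_neq0 s't)); apply: (mulIf (invr_neq0 r't)).
  transitivity (l * ((s + t) / (s' + t))); first by field; rewrite s't r't.
  by rewrite e; field; rewrite s't r't.
have [] := @Fq_indep t (l - l') (l * (s + r') - l' * (r + s'))
            (l * (s * r') - l' * (r * s')) tF.
- exact: FqB.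
- by rewrite FqB ?FqM ?FqD.
- by rewrite FqB ?FqM ?FqM.
- transitivity (l * (s + t) * (r' + t) - l' * (r + t) * (s' + t)); first by ring.
  by rewrite e subrr.
move/eqP; rewrite subr_eq0 => /eqP <-; rewrite -!mulrBr => /eqP.
rewrite mulf_eq0 (negPf l0) subr_eq0 /= => /eqP sr /eqP.
rewrite mulf_eq0 (negPf l0) subr_eq0 /= => /eqP sr'.
have /eqP : (s - s') * (s - r) = 0.
  transitivity (s ^+ 2 - s * (r + s') + r * s'); first by ring.
  by rewrite -sr -sr'; ring.
rewrite mulf_eq0 !subr_eq0 (negPf ss') /= => /eqP rs; split=> //.
by move: sr; rewrite rs => /addrI.
Qed.

(** * The group P of (2q-1)-th powers *)

Local Notation n := (2 * q).-1.
Local Notation P := (powers F n).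
Local Notation k := #|unity_roots F n|.

Lemma exprS_n (x : F) : x * x ^+ n = x ^+ (2 * q).
Proof. by rewrite -exprS prednK ?muln_gt0 ?expn_gt0. Qed.

(** A root of unity [z] here is fixed by x |-> x^(2q), whose third iterate is x |-> x^8 on F; hence
    z^7 = 1. *)
Lemma card_unity_roots_le7 : (k <= 7)%N.
Proof.
have sz : size ('X^7 - 1 : {poly F}) = 8%N.
  by rewrite size_polyDl size_polyXn // size_polyN size_poly1.
rewrite -ltnS -sz; apply: card_roots_lt; first by rewrite -size_poly_gt0 sz.
move=> z; rewrite inE => /andP[z0 /eqP zn].
have z2q : z ^+ 2 ^+ q = z by rewrite -exprM -exprS_n zn mulr1.
rewrite rootE !hornerE subr_eq0; apply/eqP/(mulfI z0); rewrite mulr1 -exprS.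
rewrite -(expq3 (z ^+ 8)) (_ : z ^+ 8 = z ^+ 2 ^+ 2 ^+ 2) -?exprM //.
have sw (x : F) i : x ^+ i ^+ q = x ^+ q ^+ i by rewrite -!exprM mulnC.
by rewrite !exprM (sw _ 2%N) (sw (_ ^+ 2)) z2q (sw _ 2%N) z2q z2q.
Qed.

Definition Fqx : {set F} := Fq :\ 0.

Lemma in_Fqx x : (x \in Fqx) = (x != 0) && (x \in Fq).
Proof. exact: in_setD1. Qed.

Lemma card_Fqx : #|Fqx| = q.-1.
Proof. by rewrite /Fqx -card_Fq (cardsD1 0 Fq) Fq0. Qed.

Lemma Fqx_powers : Fqx \subset P.
Proof.
apply/subsetP => x; rewrite !inE => /andP[x0 /eqP xq]; apply/powersP; exists x => //.
by apply: (mulfI x0); rewrite exprS_n mulnC exprM xq.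
Qed.

(** * Pairs of translates of t in a common coset of P *)

Definition ratio_pairs t : {set F * F} :=
  [set p in setX Fq Fq | (p.1 + t) / (p.2 + t) \in P].

Lemma in_ratio_pairs t s s' : ((s, s') \in ratio_pairs t) =
  [&& s \in Fq, s' \in Fq & (s + t) / (s' + t) \in P].
Proof. by rewrite inE /= in_setX andbA. Qed.

(** At most q pairs are diagonal. Scaling the ratios of the other pairs by F_q^* gives, injectively
    by [ratio_inj], elements of P outside F_q^*; leaving out F_q^* accounts for the [+ 1]. *)
Lemma card_ratio_pairs t : t \notin Fq ->
  (q.-1 * (#|ratio_pairs t| + 1) <= #|P| + q * q.-1)%N.
Proof.
move=> tF; pose D := [set p in ratio_pairs t | p.1 != p.2].
have in_D s s' : ((s, s') \in D) = ((s, s') \in ratio_pairs t) && (s != s').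
  by rewrite in_set.
have leE : (#|ratio_pairs t| <= q + #|D|)%N.
  rewrite -(cardsID D (ratio_pairs t)) addnC leq_add //; last first.
    by rewrite subset_leq_card // subsetIr.
  rewrite -card_Fq; have inj : injective (fun x : F => (x, x)) by move=> x y [].
  rewrite -(card_imset _ inj); apply: subset_leq_card; apply/subsetP => -[x y].
  rewrite in_setD in_D andbC => /andP[xyE]; rewrite xyE negbK => /eqP xy.
  move: xyE; rewrite in_ratio_pairs => /and3P[xF _ _].
  by apply/imsetP; exists x; rewrite // xy.
pose phi (u : F * F * F) := u.2 * ((u.1.1 + t) / (u.1.2 + t)).
have phi_inj : {in setX D Fqx &, injective phi}.
  move=> [[s s'] l] [[r r'] l']; rewrite /phi /= !in_setX /= !in_D !in_ratio_pairs !in_Fqx.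
  move=> /andP[/andP[/and3P[sF s'F _] ss'] /andP[l0 lF]].
  move=> /andP[/andP[/and3P[rF r'F _] _] /andP[_ l'F]] e.
  by have [-> -> ->] := ratio_inj tF sF s'F rF r'F lF l'F ss' l0 e.
have leD : (#|D| * q.-1 <= #|P| - q.-1)%N.
  rewrite -{2}card_Fqx -cardsDS ?Fqx_powers // -card_Fqx -cardsX.
  rewrite -(card_in_imset phi_inj); apply: subset_leq_card.
  apply/subsetP => _ /imsetP[[[s s'] l] /setXP[/= hD lF] ->].
  have lP := subsetP Fqx_powers l lF.
  move: hD lF; rewrite in_D in_ratio_pairs in_Fqx.
  move=> /andP[/and3P[sF s'F hP] ss'] /andP[l0 lF].
  rewrite /phi /= in_setD in_Fqx (powersMl _ lP) hP andbT negb_and negbK.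
  have s'nz : s' + t != 0 by rewrite Fq_addt_neq0.
  have snz : s + t != 0 by rewrite Fq_addt_neq0.
  rewrite !mulf_eq0 invr_eq0 (negPf l0) (negPf s'nz) (negPf snz) /=.
  (* If the scaled ratio were some [a] in F_q, then l(s + t) = a(s' + t) would force l = a and s =
     s'. *)
  apply: contra ss' => lr; set a := l * _ in lr.
  have [] := @Fq_indep t 0 (l - a) (l * s - a * s') tF.
  - by rewrite Fq0.
  - by rewrite FqB.
  - by apply: FqB; apply: FqM.
  - rewrite /a; field; exact: s'nz.
  move=> _ /eqP; rewrite subr_eq0 => /eqP <- /eqP.
  by rewrite -mulrBr mulf_eq0 (negPf l0) subr_eq0.
have q1P : (q.-1 <= #|P|)%N by rewrite -card_Fqx subset_leq_card ?Fqx_powers.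
nia.
Qed.

(** * First and second moments of the coset counts *)

Definition coset_count t a := #|[set s in Fq | a * (s + t) \in P]|.

Lemma coset_countE t a :
  coset_count t a = (\sum_(s in Fq) ((a * (s + t))%R \in P))%N.
Proof.
rewrite /coset_count -sum1_card (eq_bigl (fun s => (s \in Fq) && (a * (s + t) \in P))).
  by rewrite big_mkcondr.
by move=> s; rewrite in_set.
Qed.

Lemma sum_mem_powers u : u != 0 -> (\sum_a ((a * u)%R \in P) = #|P|)%N.
Proof.
move=> u0; rewrite -(card_powers_scale n u0) -sum1_card big_mkcond [RHS]big_mkcond.
by apply: eq_bigr => a _; rewrite in_set.
Qed.

Lemma sum_coset_count t : t \notin Fq -> (\sum_a coset_count t a = q * #|P|)%N.
Proof.
move=> tF; under eq_bigr do rewrite coset_countE.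
transitivity (#|Fq| * #|P|)%N; last by rewrite card_Fq.
rewrite exchange_big /= -sum_nat_const; apply: eq_bigr => s sF.
by rewrite sum_mem_powers ?Fq_addt_neq0.
Qed.

(** Both a(s + t) and a(s' + t) lie in P exactly when their ratio and a(s' + t) do, and the latter
    holds for |P| values of [a]. *)
Lemma sum_coset_count_sqr t : t \notin Fq ->
  (\sum_a coset_count t a ^ 2 = #|ratio_pairs t| * #|P|)%N.
Proof.
move=> tF; transitivity (\sum_a \sum_(p in ratio_pairs t) ((a * (p.2 + t))%R \in P))%N.
  apply: eq_bigr => a _; rewrite -mulnn coset_countE big_distrlr /= pair_big /=.
  rewrite big_mkcond [RHS]big_mkcond; apply: eq_bigr => -[s s'] _ /=.
  rewrite in_ratio_pairs andbA; case: (boolP (_ && _)) => //= /andP[sF s'F].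
  have s'nz : s' + t != 0 by rewrite Fq_addt_neq0.
  case: ifP => [hP|/negbT hP].
    suff -> : a * (s + t) = (s + t) / (s' + t) * (a * (s' + t)).
      by rewrite powersMl // mulnb andbb.
    by field.
  rewrite mulnb; apply/eqP; rewrite eqb0; apply: contra hP => /andP[h h'].
  suff -> : (s + t) / (s' + t) = a * (s + t) * (a * (s' + t))^-1.
    by rewrite powersM ?powersV.
  have a0 : a != 0 by apply: contraTneq h => ->; rewrite mul0r powers0.
  by field; rewrite s'nz a0.
rewrite exchange_big /= -sum_nat_const; apply: eq_bigr => -[s s'].
rewrite in_ratio_pairs => /and3P[_ s'F _].
by rewrite sum_mem_powers ?Fq_addt_neq0.
Qed.
Lemma card_unity_roots_gt0 : (0 < k)%N.
Proof. by apply/card_gt0P; exists 1; rewrite inE oner_neq0 expr1n /=. Qed.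

Lemma card_powers_n : (#|P| * k = (q ^ 3).-1)%N.
Proof. by rewrite card_powers cardF. Qed.

(* Second moment method: over all a != 0, coset_count t a has mean q / k and
   variance O(q), and each value is attained on a whole coset of P. *)
Lemma coset_count_dev t a : t \notin Fq -> a != 0 ->
  ((k * coset_count t a) ^ 2 + q ^ 2 <= 2 * (k * coset_count t a) * q + 56 * q)%N.
Proof.
move=> tF a0; pose B := coset_count t; pose p := #|P|; pose E := #|ratio_pairs t|.
pose dev c : int := ((k * B c)%:Z - q%:Z) ^+ 2.
have B0 : B 0 = 0%N.
  apply/eqP; rewrite cards_eq0; apply/eqP/setP => s.
  by rewrite !inE mul0r (negPf (powers0 _ _)) andbF.
have sumB : (\sum_(c : F | c != 0%R) B c = q * p)%N.
  by rewrite -(sum_coset_count tF) [RHS](bigD1 0) //= -/B B0.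
have sumB2 : (\sum_(c : F | c != 0%R) B c ^ 2 = E * p)%N.
  by rewrite -(sum_coset_count_sqr tF) [RHS](bigD1 0) //= -/B B0.
have cardN0 : #|[pred c : F | c != 0]| = (p * k)%N.
  by rewrite card_powers -(cardsC1 (0 : F)); apply: eq_card => c; rewrite !inE.
have sum_dev : \sum_(c | c != 0) dev c =
    k%:Z ^+ 2 * (E * p)%:Z - 2 * k%:Z * q%:Z * (q * p)%:Z + (p * k)%:Z * q%:Z ^+ 2.
  have -> : (p * k)%:Z * q%:Z ^+ 2 = \sum_(c : F | c != 0) q%:Z ^+ 2.
    by rewrite -cardN0 -natz mulr_natl -sumr_const; apply: eq_bigl.
  rewrite -sumB -sumB2 -!natz !natr_sum !mulr_sumr -sumrB -big_split /=.
  apply: eq_bigr => c _.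
  by rewrite /dev -!natz !(natrM, natrX); ring.
have coset_dev : p%:Z * dev a <= \sum_(c | c != 0) dev c.
  rewrite -natz mulr_natl -sumr_const.
  rewrite [X in _ <= X](reindex_inj (mulfI a0)) /=.
  rewrite [X in X <= _]big_mkcond [X in _ <= X]big_mkcond /=; apply: ler_sum => c _.
  have dev0 : 0 <= dev (a * c) by exact: sqr_ge0.
  case: ifP => [cP|_]; last by case: ifP.
  rewrite mulf_neq0 ?(powers_neq0 cP) //.
  rewrite /dev (_ : B (a * c) = B a) //; apply: eq_card => s; rewrite !in_set.
  by rewrite -mulrA mulrCA powersMl.
have pk : (p * k = (q ^ 3).-1)%N := card_powers_n.
have leE : (q.-1 * (E + 1) <= p + q * q.-1)%N := card_ratio_pairs tF.
have k7 := card_unity_roots_le7; have k0 := card_unity_roots_gt0.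
have p0 : (0 < p)%N by apply/card_gt0P; exists 1; exact: powers1.
by apply: (variance_bound _ pk leE) => //; rewrite -sum_dev.
Qed.

(** * The t outside F_q for which c(t), here [twist t], lies in P *)

Definition twist t : F := t * (1 + t) / (t + t ^+ q) ^+ 2.

Definition twist_powers : {set F} := [set t in ~: Fq | twist t \in P].

Lemma addtq_neq0 t : t \notin Fq -> t + t ^+ q != 0.
Proof. by apply: contra; rewrite addr_eq0 oppF inE eq_sym. Qed.

Lemma twist_scale t s : t \notin Fq -> s \in Fqx ->
  twist (t / s) = t / (t + t ^+ q) ^+ 2 * (s + t).
Proof.
move=> tF; rewrite in_Fqx => /andP[s0 /FqP sq].
rewrite /twist exprMn exprVn sq; have := addtq_neq0 tF.
by set u := t ^+ q => tu; field; rewrite s0 tu.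
Qed.

(** For each s in F_q^*, t |-> t/s permutes the complement of F_q, so [twist_scale] makes each such
    s contribute |[twist_powers]|. The coset count also admits s = 0, which adds at most 1 for each
    [t]. *)
Lemma sum_coset_count_twist :
  (\sum_(t in ~: Fq) coset_count t (t / (t + t ^+ q) ^+ 2)
   <= q.-1 * #|twist_powers| + #|~: Fq|)%N.
Proof.
rewrite -card_Fqx -sum_nat_const -[#|~: Fq|]sum1_card.
have cardT s : s \in Fqx ->
    #|twist_powers| = (\sum_(t in ~: Fq) (twist (t / s) \in P))%N.
  rewrite in_Fqx => /andP[s0 sF]; have s'0 : s^-1 != 0 by rewrite invr_eq0.
  rewrite -sum1_card (eq_bigl (fun t => (t \in ~: Fq) && (twist t \in P))); last first.
    by move=> t; rewrite in_set.
  rewrite big_mkcondr (reindex_inj (mulIf s'0)) /=; apply: eq_big => // t.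
  rewrite !in_setC; congr (~~ _); apply/idP/idP => [tF|tF]; last by rewrite FqM ?FqV.
  by rewrite -(divfK s0 t) FqM.
rewrite (eq_bigr _ cardT) exchange_big -big_split /=; apply: leq_sum => t.
rewrite in_setC => tF; rewrite coset_countE (big_setD1 0) ?Fq0 //= addnC.
rewrite leq_add ?leq_b1 //; apply: leq_sum => s sF.
by rewrite twist_scale.
Qed.

(** The 8 bounds the square root of 56 from [coset_count_dev], and the 7 bounds [k] times the
    possible extra s = 0 for each [t]; a common factor q - 1 cancels. *)
Lemma card_twist_powers (R : rcfType) :
  q%:R * (q%:R + 1) * (q%:R - 8 * Num.sqrt q%:R - 7) <= (k * #|twist_powers|)%:R :> R.
Proof.
set w := Num.sqrt _; have w2 : w ^+ 2 = q%:R by rewrite sqr_sqrtr ?ler0n.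
have w0 : 0 <= w := sqrtr_ge0 _.
pose B t := coset_count t (t / (t + t ^+ q) ^+ 2).
have cardC : #|~: Fq|%:R = q%:R ^+ 3 - q%:R :> R.
  have := cardsC Fq; rewrite card_Fq cardF => /(congr1 (fun i => i%:R : R)).
  by rewrite natrD (natrX _ q 3) => <-; rewrite addrAC subrr add0r.
have leB t : t \in ~: Fq -> q%:R - 8 * w <= k%:R * (B t)%:R :> R.
  rewrite in_setC => tF; rewrite lerBlDr -lerBlDl.
  have a0 : t / (t + t ^+ q) ^+ 2 != 0.
    rewrite mulf_neq0 ?invr_eq0 ?expf_neq0 ?addtq_neq0 //.
    by apply: contraNneq tF => ->; exact: Fq0.
  have := natr_sqrB_le R (coset_count_dev tF a0).
  rewrite -/(B t) natrM -w2; set b := k%:R * (B t)%:R => h.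
  by nra.
have q1 : 1 < q%:R :> R by rewrite ltr1n.
have k7 : k%:R <= 7 :> R by rewrite ler_nat card_unity_roots_le7.
have := sum_coset_count_twist; rewrite -(ler_nat R) natrD natrM natr_sum cardC.
move=> /(ler_wpM2l (ler0n R k)); rewrite mulr_sumr -/B.
have /le_trans /[apply] : (q%:R ^+ 3 - q%:R) * (q%:R - 8 * w) <=
    \sum_(t in ~: Fq) k%:R * (B t)%:R :> R.
  rewrite -cardC [X in X <= _]mulr_natl -sumr_const; apply: ler_sum => t; exact: leB.
have -> : q.-1%:R = q%:R - 1 :> R by rewrite -subn1 natrB 1?ltnW.
rewrite natrM.
move: (q%:R : R) (k%:R : R) (#|twist_powers|%:R : R) q1 k7 => r x T r1 x7 h.
rewrite -(ler_pM2l (_ : 0 < r - 1)) ?subr_gt0 //.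
have : 0 <= (r ^+ 3 - r) * (7 - x).
  rewrite (_ : r ^+ 3 - r = r * (r + 1) * (r - 1)); last by ring.
  by rewrite !mulr_ge0 ?subr_ge0 //; lra.
lra.
Qed.

(** * Roots of f_mu and the number of permutations *)

Definition mu_of (x : F) : F := (x ^+ (2 * q) + x) / x ^+ 2.

Lemma f1_eq0 mu x : x != 0 -> (f1 q mu x == 0) = (mu_of x == mu).
Proof.
move=> x0; rewrite /f1 /mu_of addrAC addr_eq0 oppF.
by rewrite -[RHS](inj_eq (mulIf (expf_neq0 2 x0))) divfK ?expf_neq0.
Qed.

Definition mu_roots mu : {set F} := [set x in [set~ 0] | mu_of x == mu].

Lemma exp2qD (x y : F) : (x + y) ^+ (2 * q) = x ^+ (2 * q) + y ^+ (2 * q).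
Proof. by rewrite -expnS expD2X. Qed.

(* Applying x |-> x ^+ (2 * q) twice more to x ^+ (2 * q) = mu * x ^+ 2 + x and
   using x ^+ (2 * q) ^ 3 = x ^+ 8 gives a polynomial equation of degree at
   most 8 with linear coefficient 1. *)
Lemma card_mu_roots_le7 mu : (#|mu_roots mu| <= 7)%N.
Proof.
pose N (x : F) := x ^+ (2 * q).
have ND x y : N (x + y) = N x + N y by exact: exp2qD.
have NM x y : N (x * y) = N x * N y by exact: exprMn.
have N3 x : N (N (N x)) = x ^+ 8.
  rewrite /N -!exprM -[in RHS](expq3 x) -!exprM; congr (_ ^+ _); lia.
pose a := N mu; pose b := N a.
pose c4 := b * (a + mu) ^+ 2 + a * mu ^+ 2; pose c8 := b * a ^+ 2 * mu ^+ 4 + 1.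
(* This is the equation divided by [x]: its terms in x, x^2, x^4, x^8 move to degrees 0, 1, 3, 7,
   and the constant term 1 makes [p] nonzero. *)
pose p := Poly [:: 1; b + a + mu; 0; c4; 0; 0; 0; c8].
have sz : (size p <= 8)%N by exact: size_Poly.
rewrite -ltnS; apply: leq_trans sz; apply: card_roots_lt.
  by apply/eqP => /(congr1 (fun s : {poly F} => s`_0)) /eqP; rewrite coef_Poly coef0 oner_eq0.
move=> x; rewrite !inE => /andP[x0]; rewrite -f1_eq0 // => /eqP fx.
have N1 : N x = mu * x ^+ 2 + x.
  by apply/eqP; rewrite -[X in _ == X]oppF -addr_eq0 addrA; apply/eqP.
have sqrD2 (u v : F) : (u + v) ^+ 2 = u ^+ 2 + v ^+ 2 by exact: (expD2X 1).
have N2 : N (N x) = a * (mu ^+ 2 * x ^+ 4 + x ^+ 2) + (mu * x ^+ 2 + x).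
  by rewrite [in LHS]N1 ND NM -/a expr2 NM -expr2 N1 sqrD2; ring.
have : x ^+ 8 = b * (a ^+ 2 * (mu ^+ 4 * x ^+ 8 + x ^+ 4) + mu ^+ 2 * x ^+ 4 + x ^+ 2)
         + (a * (mu ^+ 2 * x ^+ 4 + x ^+ 2) + (mu * x ^+ 2 + x)).
  transitivity (N (N (N x))); first by rewrite N3.
  rewrite [N x]N1 ND NM ND NM -/a -/b [N (N (x ^+ 2))](_ : _ = N (N x) ^+ 2).
    by rewrite N2 sqrD2 exprMn !sqrD2; ring.
  by rewrite expr2 !NM.
move/eqP; rewrite -subr_eq0 oppF => /eqP e; rewrite rootE horner_Poly /=.
apply/eqP/(mulfI x0); rewrite mulr0 -[RHS]e /c4 /c8 (sqrD2 a mu); ring.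
Qed.

Lemma sum_card_mu_roots : (\sum_mu #|mu_roots mu| = (q ^ 3).-1)%N.
Proof.
rewrite -cardF -(cardsC1 (0 : F)) (@card_sum_fibres _ _ mu_of [set~ 0] setT) //.
by apply: eq_bigl => mu; rewrite inE.
Qed.

Lemma mu_ofM t x : t \notin Fq -> x != 0 -> x ^+ n = twist t ->
  mu_of x = mu_of (x * t).
Proof.
move=> tF x0 xn; have tu := addtq_neq0 tF.
have t0 : t != 0 by apply: contraNneq tF => ->; exact: Fq0.
rewrite /mu_of exprMn -exprS_n xn /twist mulnC exprM.
set u := t + t ^+ q in tu *.
have -> : t ^+ q = u + t by rewrite /u addrC addrA addff add0r.
have two0 : 2 = 0 :> F by have := addff 1.
apply/eqP; rewrite -subr_eq0; apply/eqP.
(* In any characteristic the difference equals this multiple of 2. *)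
transitivity (- (2 * (1 + t * (1 + t) / u) / (x * t))); first by field; rewrite tu t0 x0.
by rewrite two0 !mul0r oppr0.
Qed.

(** The right side counts ordered pairs of nonzero roots of a common f_mu. The diagonal gives q^3 -
    1 of them, and each t in [twist_powers] gives k pairs (x, x t), off the diagonal because 1 is in
    F_q. *)
Lemma sum_sqr_card_mu_roots :
  ((q ^ 3).-1 + k * #|twist_powers| <= \sum_mu #|mu_roots mu| ^ 2)%N.
Proof.
rewrite sum_sqr_card_fibres -cardF -(cardsC1 (0 : F)).
set S := [set p in _ | _].
pose V := [set p : F * F | (p.1 \in twist_powers) && ((p.2 != 0) && (p.2 ^+ n == twist p.1))].
have in_V t x : ((t, x) \in V) =
    [&& t \in twist_powers, x != 0 & x ^+ n == twist t] by rewrite in_set.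
have cardV : #|V| = (k * #|twist_powers|)%N.
  rewrite (@card_sum_fibres _ _ fst V twist_powers); last first.
    by case=> t x; rewrite in_V => /andP[].
  rewrite mulnC -sum_nat_const; apply: eq_bigr => t tT.
  have : twist t \in P by move: tT; rewrite inE => /andP[].
  move/card_powers_fibre => <-; have inj : injective (pair t : F -> F * F) by move=> x y [].
  rewrite -(card_imset _ inj); apply: eq_card => -[t' x]; rewrite in_set in_V /=; apply/idP/imsetP.
    by case/andP=> /andP[_ h] /eqP tt'; exists x; rewrite ?in_set -tt'.
  by case=> y; rewrite in_set => h [-> ->]; rewrite tT h eqxx.
rewrite -cardV -(card_imset _ (_ : injective (fun x : F => (x, x)))); last by move=> x y [].
pose g (p : F * F) := (p.2, p.2 * p.1).
have g_inj : {in V &, injective g}.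
  move=> [t x] [t' x']; rewrite in_V => /and3P[_ x0 _] _ [<-].
  by move/(mulfI x0) => ->.
rewrite -(card_in_imset g_inj) -cardsUI (_ : _ :&: _ = set0) ?cards0 ?addn0; last first.
  apply/setP => p; rewrite in_set0; apply/negbTE/negP; rewrite inE.
  case/andP=> /imsetP[x _ ->] /imsetP[[t y]]; rewrite in_V => /and3P[tT y0 _] [-> e].
  have t1 : t = 1 by apply: (mulfI y0); rewrite -e mulr1.
  by move: tT; rewrite t1 !inE expr1n eqxx.
apply: subset_leq_card; apply/subsetP => p; rewrite inE => /orP[] /imsetP[].
  by move=> x; rewrite !inE => x0 ->; rewrite /= x0 eqxx.
case=> t x; rewrite in_V => /and3P[tT x0 /eqP xt] ->.
move: tT; rewrite in_set in_setC => /andP[tF _].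
have t0 : t != 0 by apply: contraNneq tF => ->; exact: Fq0.
by rewrite !inE /= x0 mulf_neq0 //= (mu_ofM tF x0 xt).
Qed.

Lemma f1_bijective mu : #|mu_roots mu| = 0%N -> bijective (f1 q mu).
Proof.
move/eqP; rewrite cards_eq0 => /eqP r0; apply: injF_bij => x y e.
apply/eqP; rewrite -subr_eq0; apply/negPn/negP => xy.
suff : x - y \in mu_roots mu by rewrite r0 inE.
rewrite !inE xy -f1_eq0 // oppF /f1 exp2qD (expD2X 1).
apply/eqP; transitivity (f1 q mu x + f1 q mu y); first by rewrite /f1; ring.
by rewrite e addff.
Qed.

(* For 0 <= r <= 7, (r - 1) * (r - 7) <= 7 * (r == 0). *)
Lemma card_bijective_f1 (b : pred F) : (forall mu, bijective (f1 q mu) -> b mu) ->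
  (7 + k * #|twist_powers| <= 7 * #|b|)%N.
Proof.
move=> hb; have le mu : (7 + #|mu_roots mu| ^ 2 <= 7 * b mu + 8 * #|mu_roots mu|)%N.
  have := card_mu_roots_le7 mu; have := @f1_bijective mu.
  case: #|_| => [/(_ erefl)/hb -> //|r _]; nia.
have : (\sum_(mu : F) (7 + #|mu_roots mu| ^ 2)
          <= \sum_(mu : F) (7 * b mu + 8 * #|mu_roots mu|))%N by apply: leq_sum.
have sum_b : (\sum_(mu : F) 7 * b mu = 7 * #|b|)%N.
  by rewrite -sum1_card [X in (7 * X)%N]big_mkcond big_distrr.
have sum_r : (\sum_(mu : F) 8 * #|mu_roots mu| = 8 * (q ^ 3).-1)%N.
  by rewrite -sum_card_mu_roots big_distrr.
(* The terms in q^3 cancel and leave 8 - 1 = 7, the source of the leading 1 in the final bound. *)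
rewrite big_split [X in (_ <= X)%N]big_split /= sum_b sum_r sum_nat_const cardF.
have := sum_sqr_card_mu_roots; have : (0 < q ^ 3)%N by rewrite expn_gt0 ltnW.
move: (q ^ 3)%N (k * _)%N (\sum_(mu : F) _)%N #|b| => [//|j] K S B _; lia.
Qed.

End Cubic.

(** * The explicit constant *)

Theorem theorem4p6 (R : realType) :
  exists2 C : R, 0 < C &
    forall (m : nat) (F : finFieldType),
      (1 <= m)%N ->
      let q := (2 ^ m)%N in
      #|F| = (q ^ 3)%N ->
      1 + (q%:R ^+ 3 - C * q%:R `^ (5 / 2)) / 7
        <= #|[pred mu : F | `[< bijective (f1 q mu) >]]|%:R.
Proof.
(* With w = sqrt q >= 1, the product w^2 (w^2 + 1)(w^2 - 8w - 7) is at least w^6 - (8 + 6 + 8 + 7)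
   w^5, so 30 suffices. *)
exists 30 => // m F m_gt0 q cardF.
have := @card_twist_powers m F m_gt0 cardF R.
set b := [pred mu | _].
have := @card_bijective_f1 m F m_gt0 cardF b (fun mu h => asboolT h).
rewrite -(ler_nat R) natrD [(7 * _)%:R]natrM -/q.
have -> : q%:R `^ (5 / 2) = Num.sqrt q%:R ^+ 5 :> R.
  by rewrite mulrC powRrM powR12_sqrt ?ler0n // powR_mulrn ?sqrtr_ge0.
set w := Num.sqrt _; have w2 : q%:R = w ^+ 2 by rewrite sqr_sqrtr ?ler0n.
have w1 : 1 <= w by rewrite -[1]sqrtr1 ler_sqrt ?ler1n ?expn_gt0.
move: (_ * _)%N => M h1; rewrite w2 => h2.
have pow_le i j : (i <= j)%N -> w ^+ i <= w ^+ j by exact: ler_weXn2l.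
have h3 : w ^+ 6 - 30 * w ^+ 5 <= w ^+ 2 * (w ^+ 2 + 1) * (w ^+ 2 - 8 * w - 7).
  have := pow_le 2%N 5%N isT; have := pow_le 3%N 5%N isT; have := pow_le 4%N 5%N isT.
  have : 0 <= w ^+ 5 by rewrite exprn_ge0 //; lra.
  lra.
rewrite -exprM. lra.
Qed.
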